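(* Let $d,k$ be positive integers, $\lambda_c=\frac{d^d}{k(d-1)^{d+1}}$ (interpreted as $\infty$ if $d=1$), and assume $0<\lambda\le\lambda_c$. Let $f(x)=\frac{k\lambda}{(1+x)^d}$, let $\hat x>0$ be its unique positive fixed point, and note $|f'(\hat x)|=\frac{d\hat x}{1+\hat x}$. Then independent sets of $\mathbb{T}_{k,d}$ with activity $\lambda$ exhibit weak spatial mixing with a rate $\delta(\ell)$ such that, for all sufficiently large $\ell$: (1) if $\lambda<\lambda_c$ then $\delta(\ell)\le C_1|f'(\hat x)|^{\ell-4}$; (2) if $\lambda=\lambda_c$ then $\delta(\ell)\le\frac{C_2}{\sqrt{\ell-\ell_0}}$; where $C_1,C_2,\ell_0>0$ are finite constants depending only on $k,d,\lambda$.
   Context: $\mathbb{T}_{k,d}$ is the infinite $(k+1)$-uniform $(d+1)$-regular hypertree (incidence graph is the infinite tree with vertex-nodes of degree $d+1$ and hyperedge-nodes of degree $k+1$). Independent sets: vertex sets meeting each hyperedge in at most one vertex; Gibbs measure $\propto\lambda^{|I|}$. For a finite vertex set $\Psi$, consider the Gibbs measure on independent sets of $\mathbb{T}_{k,d}$ contained in $\Psi$ (i.e. conditioned on vertices outside $\Psi$ adjacent to $\Psi$ being unoccupied); for $v\in\Psi$, $\Lambda\subseteq\Psi$, $\sigma_\Lambda\in\{0,1\}^\Lambda$, $p_v^{\sigma_\Lambda}$ is the conditional probability that $v$ is occupied given states $\sigma_\Lambda$ on $\Lambda$. Weak spatial mixing with rate $\delta$ means: for every finite $\Psi$, all $v,\Lambda$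 and $\sigma_\Lambda,\tau_\Lambda$, $|p_v^{\sigma_\Lambda}-p_v^{\tau_\Lambda}|\le\delta(\mathrm{dist}(v,\Lambda))$, with distance the shortest-path distance in $\mathbb{T}_{k,d}$. *)

(* Defs.v *)
From HB Require Import structures.
From mathcomp Require Import all_boot all_order all_algebra finmap.
From mathcomp Require Import boolp classical_sets functions cardinality.
From mathcomp Require Import reals ereal topology normedtype derive.

Set Implicit Arguments.
Unset Strict Implicit.
Unset Printing Implicit Defensive.

Import Order.TTheory GRing.Theory Num.Theory.
Import numFieldNormedType.Exports.

Local Open Scope fset_scope.
Local Open Scope ring_scope.

(* The length bound excludes the closed walks x, y, x, which [ucycle] accepts
   for a symmetric relation. *)
Definition is_tree (N : eqType) (g : rel N) : Prop :=
  [/\ inhabited N,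
      forall x y : N, exists2 p : seq N, path g x p & last x p = y
    & forall p : seq N, (2 < size p)%N -> ~ ucycle g p].

Definition has_degree (N : eqType) (g : rel N) (x : N) (n : nat) : Prop :=
  ([set y | g x y]%classic #= `I_n)%card.

Record hypergraph := Hypergraph {
  vertex : choiceType;
  hyperedge : choiceType;
  incident : vertex -> hyperedge -> bool }.

Definition incidence_graph (T : hypergraph) : rel (vertex T + hyperedge T) :=
  fun x y => match x, y with
             | inl v, inr e | inr e, inl v => incident v e
             | _, _ => false
             end.

(* T is (a copy of) the infinite (k+1)-uniform (d+1)-regular hypertree: these
   conditions determine T up to isomorphism, and T is infinite as soon as k and
   d are positive. *)
Definition is_hypertree (k d : nat) (T : hypergraph) : Prop :=
  [/\ is_tree (@incidence_graph T),
      forall v : vertex T, has_degree (@incidence_graph T) (inl v) d.+1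
    & forall e : hyperedge T, has_degree (@incidence_graph T) (inr e) k.+1].

Definition adjacent (T : hypergraph) : rel (vertex T) :=
  fun u w => (u != w) && `[< exists e, incident u e /\ incident w e >].

(* [is_dist v L l] says dist(v, L) = l; a path is counted by its number of
   hyperedges, i.e. half of its length in the incidence graph. No l qualifies
   when L is empty, where the distance is infinite. *)
Definition is_dist (T : hypergraph) (v : vertex T) (L : {fset vertex T})
    (l : nat) : Prop :=
  (exists p, [/\ path (@adjacent T) v p, last v p \in L & size p = l]) /\
  (forall p, path (@adjacent T) v p -> last v p \in L -> (l <= size p)%N).

Definition independent (T : hypergraph) (I : {fset vertex T}) : Prop :=
  forall (e : hyperedge T) (u w : vertex T), u \in I -> w \in I ->
    incident u e -> incident w e -> u = w.

Section Gibbs.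
Variables (R : realType) (T : hypergraph) (lambda : R) (Psi : {fset vertex T}).

Definition partition_function : R :=
  \sum_(I <- fpowerset Psi | `[< independent I >]) lambda ^+ #|` I|.

Definition gibbs (I : {fset vertex T}) : R :=
  if (I `<=` Psi) && `[< independent I >]
  then lambda ^+ #|` I| / partition_function else 0.

Definition gibbs_pr (A : pred {fset vertex T}) : R :=
  \sum_(I <- fpowerset Psi | A I) gibbs I.

Definition agrees (L : {fset vertex T}) (sigma : {ffun L -> bool}) :
    pred {fset vertex T} :=
  fun I => [forall u : L, (val u \in I) == sigma u].

Definition feasible (L : {fset vertex T}) (sigma : {ffun L -> bool}) : Prop :=
  0 < gibbs_pr (agrees sigma).

Definition marginal (v : vertex T) (L : {fset vertex T})
    (sigma : {ffun L -> bool}) : R :=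
  gibbs_pr (fun I => (v \in I) && agrees sigma I) / gibbs_pr (agrees sigma).

End Gibbs.

(* Conditional probabilities given an event of probability 0 are undefined,
   hence the feasibility assumptions. *)
Definition weak_spatial_mixing (R : realType) (T : hypergraph) (lambda : R)
    (delta : nat -> R) : Prop :=
  forall (Psi : {fset vertex T}) (v : vertex T) (L : {fset vertex T})
         (sigma tau : {ffun L -> bool}) (l : nat),
    v \in Psi -> L `<=` Psi ->
    feasible lambda Psi sigma -> feasible lambda Psi tau ->
    is_dist v L l ->
    `|marginal lambda Psi v sigma - marginal lambda Psi v tau| <= delta l.

Definition lambda_c (R : realType) (k d : nat) : \bar R :=
  if d == 1%N then +oo%E
  else (d%:R ^+ d / (k%:R * (d%:R - 1) ^+ d.+1))%:E.

Definition tree_map (R : realType) (k d : nat) (lambda : R) : R -> R :=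
  fun x => k%:R * lambda / (1 + x) ^+ d.

(* Main.v *)
Require Import Defs.
From mathcomp Require Import all_boot all_order all_algebra finmap.
From mathcomp Require Import boolp classical_sets functions cardinality.
From mathcomp Require Import reals ereal topology normedtype derive.
From mathcomp Require Import exp.
From mathcomp Require Import zify ring lra.

(* Deleting vertices edge by edge writes the odds of a vertex, in any finite
   vertex set S, as lambda * prod_e 1 / (1 + sum_(w in e) odds of w), where the
   odds on the right are taken in smaller sets. Two boundary conditions amount
   to two sets S, S' that agree on a large ball. Let (a_n, b_n) be the extreme
   values on the regular tree: (a_0, b_0) = (0, f 0), a_(n+1) = f b_n,
   b_(n+1) = f a_n. If S and S' agree up to distance n, then the pair (s, t) of
   k-fold odds satisfies a_n t <= b_n s and
   (1 + a_n) (1 + t) <= (1 + b_n) (1 + s), so the regular tree is the worst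
   case; with mu = b (1 + a) / (a (1 + b)), which decreases in n, the induction
   step follows from Bernoulli's inequality with exponent mu, used twice.

   For the rate, write a_n = xhat (1 - A_n) and b_n = xhat (1 + B_n). The
   polynomial inequality 2 (1 + z + ... + z^(d-1)) <= (d-1) z^d + d + 1
   - [d > 1] (z - 1)^2 gives, with r = |f' xhat| and theta = (d+1)/(2d),
   1/A_(n+1) >= theta + 1/(r B_n) + kappa B_n and
   1/B_(n+1) >= - theta + 1/(r A_n) + kappa A_n. Shifting 1/B_n and 1/A_n by
   +tau and -tau, tau = theta r / (1 + r), removes the constants and leaves
   growth by 1/r at each step; when r = 1, two steps give
   1/A_(n+2) >= 1/A_n + kappa A_n, so 1/A_n^2 grows linearly. *)

Import Order.TTheory GRing.Theory Num.Theory.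
Import numFieldNormedType.Exports.

Local Open Scope classical_set_scope.
Local Open Scope ring_scope.

(** * Inequalities that carry the comparison through one vertex *)

Section RatioBounds.
Set Implicit Arguments.
Unset Strict Implicit.
Variable R : realType.
Implicit Types a b c s t y m P Q : R.

(** Factor out one [y]: the rest is [expR ((m - 1) * ln y)], and [1 + x <= expR x] with
    [1 - y^-1 <= ln y] bounds it by [1 + (m - 1) * (1 - y^-1)]. Multiplied by [y], this is exactly
    the left side. *)
Lemma powR_bernoulli y m : 0 < y -> 1 <= m -> 1 + m * (y - 1) <= y `^ m.
Proof.
move=> y0 m1; have m0 : 0 < m by lra.
rewrite -(mulr_powRB1 (ltW y0) m0) /powR gt_eqF//.
have yV : y * y^-1 = 1 by rewrite divff// gt_eqF.
have ln_ge : 1 - y^-1 <= ln y.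
  have h : -1 < y^-1 - 1 by have := invr_gt0 y; rewrite y0; lra.
  have := le_ln1Dx h; rewrite addrCA subrr addr0 lnV ?posrE//; lra.
have e := expR_ge1Dx ((m - 1) * ln y).
have e' : 1 + (m - 1) * (1 - y^-1) <= 1 + (m - 1) * ln y.
  by rewrite lerD2l ler_wpM2l//; lra.
apply: le_trans (ler_wpM2l (ltW y0) (le_trans e' e)).
by rewrite le_eqVlt; apply/orP; left; apply/eqP; nra.
Qed.

Definition ratio_bounds a b s t : Prop :=
  a * t <= b * s /\ (1 + a) * (1 + t) <= (1 + b) * (1 + s).

(** In the coordinates [(1 + s) / (1 + a)] and [(1 + t) / (1 + b)], the line [a * t = b * s] passes
    through the point (1, 1) with this slope. *)
Definition slope a b : R := (b * (1 + a)) / (a * (1 + b)).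

(* Bounds on the product of m factors 1 + t (for P) and 1 + s (for Q). *)
Definition prod_bounds a b (m : nat) P Q : Prop :=
  (1 + a) ^+ m * P <= (1 + b) ^+ m * Q /\
  (0 < a -> P / (1 + b) ^+ m <= (Q / (1 + a) ^+ m) `^ slope a b).

Lemma slope_ge1 a b : 0 < a -> a <= b -> 1 <= slope a b.
Proof. by move=> a0 ab; rewrite /slope ler_pdivlMr ?mulr_gt0//; nra. Qed.

Lemma prod_bounds0 a b : prod_bounds a b 0 1 1.
Proof. by split => [|_]; rewrite !expr0 ?divr1 ?powR1 ?mulr1. Qed.

(** The bound [a * t <= b * s] puts the new factor below a line through (1, 1); Bernoulli replaces
    the line by a power, a form that products preserve. *)
Lemma prod_bounds_cons a b (m : nat) P Q s t :
  0 <= a -> a <= b -> 0 <= s -> 0 <= t -> 0 < P -> 0 < Q ->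
  ratio_bounds a b s t -> prod_bounds a b m P Q ->
  prod_bounds a b m.+1 ((1 + t) * P) ((1 + s) * Q).
Proof.
move=> a0 ab s0 t0 P0 Q0 [st1 st2] [PQ1 PQ2]; split=> [|ap].
  rewrite !exprS mulrACA [leRHS]mulrACA ler_pM//; first nra.
  by rewrite mulr_ge0 ?ltW// exprn_gt0//; lra.
have [ap1 bp1] : 0 < 1 + a /\ 0 < 1 + b by lra.
rewrite !exprS !invfM mulrACA [X in _ <= X `^ _]mulrACA.
have sa : 0 < (1 + s) / (1 + a) by rewrite divr_gt0//; lra.
have Qa : 0 <= Q / (1 + a) ^+ m by rewrite divr_ge0 ?exprn_ge0// ltW.
have [t1 s1] : 0 <= 1 + t /\ 0 < 1 + s by lra.
rewrite (powRM _ (ltW sa) Qa).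
apply: (ler_pM _ _ _ (PQ2 ap)); rewrite ?divr_ge0 ?exprn_ge0 ?(ltW bp1) ?(ltW P0)//.
apply: le_trans (powR_bernoulli sa (slope_ge1 ap ab)).
have -> : 1 + slope a b * ((1 + s) / (1 + a) - 1) =
          (1 + b + b / a * (s - a)) / (1 + b).
  by rewrite /slope; field; lra.
rewrite ler_pM2r ?invr_gt0//.
have -> : 1 + b + b / a * (s - a) = 1 + b * s / a by field; lra.
by rewrite lerD2l ler_pdivlMr// mulrC.
Qed.

(** The hypotheses on [c] say that the new interval lies inside [[a, b]], so that [slope] decreases.
    Inversion turns the first bound on [P] and [Q] into the first ratio bound; the second one needs
    a case split. *)
Lemma prod_bounds_step (d : nat) a b c P Q :
  0 <= a -> a <= b -> 0 < c -> 1 <= P -> 1 <= Q ->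
  a <= c / (1 + b) ^+ d -> c / (1 + a) ^+ d <= b ->
  prod_bounds a b d P Q ->
  ratio_bounds (c / (1 + b) ^+ d) (c / (1 + a) ^+ d) (c / P) (c / Q).
Proof.
move=> a0 ab c0 P1 Q1.
have [ap1 bp1] : 0 < 1 + a /\ 0 < 1 + b by lra.
have [P0 Q0] : 0 < P /\ 0 < Q by lra.
have Ap : 0 < (1 + a) ^+ d by rewrite exprn_gt0.
have Bp : 0 < (1 + b) ^+ d by rewrite exprn_gt0.
have A1 : 1 <= (1 + a) ^+ d by rewrite exprn_ege1//; lra.
have AB : (1 + a) ^+ d <= (1 + b) ^+ d by rewrite lerXn2r ?nnegrE//; lra.
have A_eq1 : a = 0 -> (1 + a) ^+ d = 1 by move=> ->; rewrite addr0 expr1n.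
rewrite /prod_bounds; move: Ap Bp AB A1 A_eq1.
move: ((1 + a) ^+ d) ((1 + b) ^+ d) => A B Ap Bp AB A1 A_eq1 aa' bb' [PQ1 PQ2].
set a' := c / B in aa' *; set b' := c / A in bb' *.
set s := c / P; set t := c / Q.
have [a'0 b'0 s0 t0] : [/\ 0 < a', 0 < b', 0 < s & 0 < t].
  by split; rewrite divr_gt0.
have rat : a' * t <= b' * s.
  rewrite /a' /b' /t /s mulrACA [leRHS]mulrACA -!invfM ler_pM2l ?mulr_gt0//.
  by rewrite lef_pV2 ?posrE ?mulr_gt0.
split=> //.
have a'b' : a' <= b' by rewrite /a' /b' ler_pM2l// lef_pV2 ?posrE.
(* If [A <= Q] then [t <= b'], and [a' * t <= b' * s] yields [t - s <= b' - a']; the sum of the last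
   two is the claim. *)
have [QA|QA] := leP A Q.
  have tb : t <= b' by rewrite /t /b' ler_pM2l// lef_pV2 ?posrE.
  have : (t - s) * b' <= (b' - a') * b' by nra.
  rewrite ler_pM2r//; lra.
(* Now [Q < A]; [a = 0] would force [A = 1 <= Q]. *)
have ap : 0 < a.
  by rewrite lt_neqAle a0 andbT eq_sym; apply/eqP => /A_eq1 A1'; lra.
set y := A / Q; have y0 : 0 < y by rewrite divr_gt0.
have y1 : 1 <= y by rewrite ler_pdivlMr// mul1r ltW.
have ty : t = b' * y by rewrite /t /b' /y; field; lra.
have sy : a' * y `^ slope a b <= s.
  have -> : s = a' * (P / B)^-1 by rewrite /s /a'; field; lra.
  rewrite ler_pM2l// -[leRHS]mul1r ler_pdivlMr ?divr_gt0//.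
  apply: le_trans (ler_wpM2l (powR_ge0 _ _) (PQ2 ap)) _.
  have QA0 : 0 <= Q / A by rewrite divr_ge0 ?ltW.
  rewrite -(powRM _ (ltW y0) QA0) /y.
  by rewrite mulrA divfK ?divff ?powR1// gt_eqF.
have m1 := slope_ge1 ap ab.
have sy' : a' * (1 + slope a b * (y - 1)) <= s.
  by apply: le_trans sy; rewrite ler_pM2l//; exact: powR_bernoulli.
(* This is [slope a' b' <= slope a b], because [x / (1 + x)] increases in [x]. With [s] replaced by
   its lower bound in [sy'], the claim is an equality at [y = 1], so it remains to compare the
   coefficients of [y - 1]. *)
have psi : (1 + a') * b' <= (1 + b') * (a' * slope a b).
  have -> : (1 + b') * (a' * slope a b) =
            (1 + b') * (a' * (b * (1 + a))) / (a * (1 + b)).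
    by rewrite /slope; field; lra.
  rewrite ler_pdivlMr ?mulr_gt0//.
  have e1 : a * (1 + a') <= a' * (1 + a) by nra.
  have e2 : b' * (1 + b) <= b * (1 + b') by nra.
  have p1 : 0 <= a * (1 + a') by rewrite mulr_ge0 ?ltW//; lra.
  have p2 : 0 <= b' * (1 + b) by rewrite mulr_ge0 ?ltW//; lra.
  have := ler_pM p1 p2 e1 e2.
  by rewrite mulrACA [leRHS]mulrACA; congr (is_true (_ <= _)); ring.
rewrite ty.
have psi' := ler_wpM2r (_ : 0 <= y - 1) psi.
have {}psi' := psi' ltac:(lra).
have b'1 : 0 < 1 + b' by lra.
have := ler_wpM2l (ltW b'1) sy'; nra.
Qed.

(** With [g = m%:R * (b - a)], induction on the exponent gives
    [(1 + b) ^+ m * (1 - g) <= (1 + a) ^+ m], hence [P - Q <= g * P]. Dividing by [Q * P] and using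
    [1 <= Q] leaves [g]. *)
Lemma inv_gap a b (m : nat) P Q : 0 <= a -> a <= b -> 1 <= P -> 1 <= Q ->
  (1 + a) ^+ m * P <= (1 + b) ^+ m * Q -> Q^-1 - P^-1 <= m%:R * (b - a).
Proof.
move=> a0 ab P1 Q1 PQ.
have [P0 Q0] : 0 < P /\ 0 < Q by lra.
have [ap1 bp1] : 0 < 1 + a /\ 0 < 1 + b by lra.
have ind (j : nat) : (1 + b) ^+ j * (1 - j%:R * (b - a)) <= (1 + a) ^+ j.
  elim: j => [|j IHj]; first by rewrite !expr0 mul0r subr0 mulr1.
  rewrite !exprS; apply: le_trans (ler_wpM2l (ltW ap1) IHj).
  rewrite -subr_ge0 (_ : _ - _ = (1 + b) ^+ j * ((b - a) * (j%:R * (b - a) + b))).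
    have ba : 0 <= b - a by lra.
    have jba : 0 <= j%:R * (b - a) by rewrite mulr_ge0 ?ler0n.
    by rewrite mulr_ge0 ?exprn_ge0 ?mulr_ge0 ?(ltW bp1)//; lra.
  by rewrite [j.+1%:R]mulrS; ring.
have {}ind := ind m.
have gap0 : 0 <= m%:R * (b - a) by rewrite mulr_ge0 ?ler0n//; lra.
move: gap0 ind PQ; move: (m%:R * (b - a)) => g g0.
have Bp : 0 < (1 + b) ^+ m by rewrite exprn_gt0.
move: ((1 + a) ^+ m) ((1 + b) ^+ m) Bp => A B Bp AB PQ.
have QP : (1 - g) * P <= Q.
  by rewrite -(ler_pM2l Bp); apply: le_trans PQ; rewrite mulrA ler_pM2r.
have -> : Q^-1 - P^-1 = (P - Q) / (Q * P) by field; lra.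
rewrite ler_pdivrMr ?mulr_gt0//.
have : g * P <= g * (Q * P) by rewrite ler_wpM2l// ler_peMl// ltW.
by lra.
Qed.
End RatioBounds.

(** * Partition functions under deletion, and the recursion for odds *)

Section Recursion.
Set Implicit Arguments.
Unset Strict Implicit.
Local Open Scope fset_scope.
Local Open Scope ring_scope.
Variables (R : realType) (T : hypergraph) (lambda : R).
Implicit Types (S L O I J : {fset vertex T}) (u v w : vertex T).

(** Unlike [adjacent], this allows [u = w]: a vertex on some edge meets itself, so deleting all that
    [u] meets deletes [u] too. *)
Definition meets u w : bool := `[< exists e, incident u e /\ incident w e >].

Lemma independent_sub I J : I `<=` J -> independent J -> independent I.
Proof.
by move=> /fsubsetP IJ indJ e u w uI wI; apply: indJ; exact: IJ.
Qed.

Lemma independent0 : independent (fset0 : {fset vertex T}).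
Proof. by move=> e u w; rewrite inE. Qed.

(** An independent set with trace [O] on [L] is, uniquely, [O] together with an independent subset
    of [S0]. This serves boundary conditions, an occupied vertex ([L] and [O] the same singleton)
    and vacant sites ([O] empty). *)
Lemma pinned_sum S S0 L O :
  O `<=` S -> O `<=` L -> independent O ->
  (forall w, (w \in S0) = [&& w \in S, w \notin L & `[< forall o, o \in O -> ~~ meets o w >]]) ->
  \sum_(I <- fpowerset S | `[< independent I >] && (I `&` L == O))
     lambda ^+ #|` I| = lambda ^+ #|` O| * partition_function lambda S0.
Proof.
move=> OS OL indO S0E.
have dj J : J `<=` S0 -> O `&` J = fset0.
  move=> /fsubsetP JS0; apply/fsetP => x; rewrite !inE; apply/negP => /andP[xO /JS0].
  by rewrite S0E (fsubsetP OL _ xO) andbF.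
have card J : J `<=` S0 -> #|` O `|` J| = (#|` O| + #|` J|)%N.
  by move=> /dj OJ; rewrite cardfsU OJ cardfs0 subn0.
rewrite /partition_function big_distrr/= -big_filter -[RHS]big_filter.
set s1 := [seq _ <- _ | _ && _]; set s2 := [seq _ <- _ | _].
have perm : perm_eq s1 [seq O `|` J | J <- s2].
  apply: uniq_perm.
  - exact/filter_uniq/fset_uniq.
  - rewrite map_inj_in_uniq ?filter_uniq ?fset_uniq// => J J'.
    rewrite !mem_filter !fpowersetE => /andP[_ JS] /andP[_ J'S] eJ.
    have h K : K `<=` S0 -> (O `|` K) `\` O = K.
      move=> /dj/fsetP OK; apply/fsetP => x; move: (OK x); rewrite !inE.
      by case: (x \in O) => //= ->.
    by rewrite -(h J)// eJ h.
  move=> I; rewrite mem_filter fpowersetE; apply/idP/mapP.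
    move=> /andP[/andP[/asboolP indI /eqP IL] IS].
    have OI : O `<=` I by rewrite -IL fsubsetIl.
    exists (I `\` O); last by rewrite fsetUDl fsetDv fsetD0; apply/esym/fsetUidPr.
    rewrite mem_filter fpowersetE; apply/andP; split.
      by apply/asboolP; apply: independent_sub indI; exact: fsubsetDl.
    apply/fsubsetP => x; rewrite inE => /andP[xO xI].
    rewrite S0E (fsubsetP IS _ xI)/=; apply/andP; split.
      by apply: contra xO => xL; rewrite -IL inE xI.
    apply/asboolP => o oO; apply/negP => /asboolP[e [oe xe]].
    by move: xO; rewrite (indI e x o xI (fsubsetP OI _ oO) xe oe) oO.
  move=> [J]; rewrite mem_filter fpowersetE => /andP[/asboolP indJ JS] ->.
  have JS' x : x \in J -> [/\ x \in S, x \notin L & forall o, o \in O -> ~~ meets o x].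
    by move=> /(fsubsetP JS); rewrite S0E => /and3P[? ? /asboolP].
  apply/andP; split; [apply/andP; split|].
  - apply/asboolP => e x y; rewrite !inE => /orP[xO|xJ] /orP[yO|yJ] xe ye.
    + exact: indO xe ye.
    + by have [_ _ /(_ _ xO)/negP[]] := JS' _ yJ; apply/asboolP; exists e.
    + by have [_ _ /(_ _ yO)/negP[]] := JS' _ xJ; apply/asboolP; exists e.
    + exact: indJ xe ye.
  - apply/eqP/fsetP => x; rewrite !inE; apply/idP/idP.
      move=> /andP[/orP[//|xJ] xL]; have [_] := JS' _ xJ; by rewrite xL.
    by move=> xO; rewrite xO (fsubsetP OL).
  - by rewrite fsubUset OS; apply/fsubsetP => x /JS'[].
rewrite (perm_big _ perm) big_map/= [LHS]big_seq [RHS]big_seq.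
apply: eq_bigr => J; rewrite mem_filter fpowersetE => /andP[_ JS].
by rewrite card// exprD.
Qed.

Hypothesis lambda_gt0 : 0 < lambda.
Hypothesis incident_exists : forall v, exists e : hyperedge T, incident v e.

Notation Z := (partition_function lambda).

Lemma partition_function_gt0 S : 0 < Z S.
Proof.
rewrite /partition_function big_mkcond/= (bigD1_seq fset0) ?fset_uniq//=; last first.
  by rewrite fpowersetE fsub0set.
rewrite asboolT/=; last exact: independent0.
rewrite expr0 ltr_pwDl// sumr_ge0// => I _.
by case: ifP => // _; rewrite exprn_ge0// ltW.
Qed.

Definition away S u := [fset w in S | ~~ meets u w].
Definition remove S (e : hyperedge T) := [fset w in S | ~~ incident w e].

Lemma meetsxx u : meets u u.
Proof. by have [e ue] := incident_exists u; apply/asboolP; exists e. Qed.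

Lemma independent1 u : independent [fset u].
Proof. by move=> e x y; rewrite !inE => /eqP -> /eqP ->. Qed.

Lemma occupied_sum S u : u \in S ->
  \sum_(I <- fpowerset S | `[< independent I >] && (u \in I)) lambda ^+ #|` I| =
  lambda * Z (away S u).
Proof.
move=> uS; rewrite -[X in X * _]expr1 -(cardfs1 u).
rewrite -(@pinned_sum S (away S u) [fset u] [fset u])//.
- apply: eq_bigl => I; congr (_ && _); apply/idP/eqP => [uI|].
    by apply/fsetP => x; rewrite !inE; case: eqP => [->|]; rewrite ?uI ?andbF.
  by move/fsetP/(_ u); rewrite !inE eqxx andbT.
- by rewrite fsub1set.
- exact: independent1.
move=> w; rewrite !inE/=; congr (_ && _); apply/idP/andP.
  move=> uw; split; first by apply: contra uw => /eqP ->; exact: meetsxx.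
  by apply/asboolP => o; rewrite inE => /eqP ->.
by move=> [_ /asboolP]; apply; rewrite inE.
Qed.

(** For [u] outside [S], the weight of [u] occupied over that of [u] vacant in [S] enlarged by
    [u]. *)
Definition odds S u : R := lambda * Z (away S u) / Z S.

Lemma odds_ge0 S u : 0 <= odds S u.
Proof. by rewrite divr_ge0 ?mulr_ge0 ?ltW ?partition_function_gt0. Qed.

Lemma removeE S e w : (w \in remove S e) = (w \in S) && ~~ incident w e.
Proof. by rewrite !inE. Qed.

Lemma away_remove S w e : incident w e -> away (remove S e) w = away S w.
Proof.
move=> we; apply/fsetP => x; rewrite !inE/= -andbA; congr (_ && _).
apply: andb_idl; apply: contra => xe; apply/asboolP; by exists e.
Qed.

(** An independent set has at most one vertex on [e]; split by which one. If it is [w], the rest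
    avoids [e], so [away S w] may be computed after removing [e]. *)
Lemma partition_function_edge S e :
  Z S = Z (remove S e) *
        (1 + \sum_(w <- [fset w in S | incident w e]) odds (remove S e) w).
Proof.
set W := [fset w in S | incident w e].
have -> : Z S = Z (remove S e) + \sum_(w <- W) lambda * Z (away S w).
  rewrite [LHS](bigID (fun I => I `&` W == fset0))/=; congr (_ + _).
    rewrite (@pinned_sum S (remove S e) W fset0 (fsub0set _) (fsub0set _) independent0).
      by rewrite cardfs0 expr0 mul1r.
    move=> w; rewrite !inE/=; case: (w \in S) => //=.
    by rewrite (asboolT (P := forall o, _)) ?andbT// => o; rewrite inE.
  have -> : \sum_(w <- W) lambda * Z (away S w) =
     \sum_(w <- W) \sum_(I <- fpowerset S)
        (if `[< independent I >] && (w \in I) then lambda ^+ #|` I| else 0).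
    rewrite [LHS]big_seq [RHS]big_seq; apply: eq_bigr => w.
    rewrite !inE => /andP[wS _]; by rewrite -big_mkcond -occupied_sum.
  rewrite exchange_big/= big_mkcond/=; apply: eq_bigr => I _.
  case: (asboolP (independent I)) => [indI|_] /=; last by rewrite big1.
  have [/eqP/fsetP I0|/fset0Pn[x]] := boolP (I `&` W == fset0).
    rewrite big_seq big1// => w wW; case: ifP => // wI.
    by have := I0 w; rewrite in_fset0 in_fsetI wI wW.
  rewrite in_fsetI => /andP[xI xW]; rewrite (bigD1_seq x) ?fset_uniq//= xI.
  rewrite big_seq_cond big1 ?addr0// => w /andP[wW wx]; case: ifP => // wI.
  move: xW wW; rewrite !inE => /andP[_ xe] /andP[_ we].
  by rewrite (indI e w x) ?eqxx in wx.
have Z0 : Z (remove S e) != 0 by rewrite gt_eqF// partition_function_gt0.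
rewrite mulrDr mulr1 big_distrr/=; congr (_ + _).
rewrite [LHS]big_seq [RHS]big_seq; apply: eq_bigr => w.
rewrite !inE => /andP[_ we].
by rewrite /odds away_remove// [RHS]mulrC divfK.
Qed.

Lemma foldl_removeE S es w :
  (w \in foldl remove S es) = (w \in S) && all (fun e => ~~ incident w e) es.
Proof. by elim: es S => [|e es IH] S /=; rewrite ?andbT// IH removeE andbA. Qed.

(** Reaching [away S u] edge by edge makes [Z S / Z (away S u)] a telescoping product of edge
    factors. *)
Lemma away_foldl S u es : (forall e, (e \in es) = incident u e) ->
  away S u = foldl remove S es.
Proof.
move=> esE; apply/fsetP => w; rewrite foldl_removeE !inE/=; congr (_ && _).
apply/idP/allP => [uw e|].
  by rewrite esE => ue; apply: contra uw => we; apply/asboolP; exists e.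
by move=> h; apply/negP => /asboolP[e [ue we]]; move: (h e); rewrite esE ue we => /(_ isT).
Qed.

Lemma remove_disjoint S e : (forall w, w \in S -> ~~ incident w e) -> remove S e = S.
Proof.
by move=> Se; apply/fsetP => w; rewrite removeE; apply: andb_idr; exact: Se.
Qed.

(** Paths run in the whole hypergraph, so distances do not change as vertices are deleted. *)
Definition same_ball (n : nat) S S' u :=
  forall p, path (@adjacent T) u p -> (size p <= n)%N ->
    (last u p \in S) = (last u p \in S').

Lemma same_ball_remove n S S' u w e : u \notin S -> w \in S ->
  incident u e -> incident w e -> same_ball n.+1 S S' u ->
  same_ball n (remove S e) (remove S' e) w.
Proof.
move=> uS wS ue we SS' p wp pn; rewrite !removeE.
rewrite (SS' (w :: p))//= wp andbT /adjacent.
rewrite (contraNneq _ uS) => [/=|->//].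
by apply/asboolP; exists e.
Qed.

(** * Comparison of two vertex sets with the regular tree *)

Variable k : nat.
Hypothesis k_gt0 : (0 < k)%N.
Hypothesis edge_card : forall S u e,
  incident u e -> u \notin S -> (#|` [fset w in S | incident w e]| <= k)%N.

(** Removing [e] splits off the factor [1 +] the sum of the odds of its vertices, taken in sets free
    of [e] that agree on a ball of radius [n]. As [e] has at most [k] such vertices, averaging the
    bounds on their [k]-fold odds gives [ratio_bounds] for the sums. *)
Lemma edges_bounds n (a b : R) S S' u es : 0 <= a -> a <= b ->
  (forall S S' w e, incident w e ->
     (forall x, x \in S -> ~~ incident x e) ->
     (forall x, x \in S' -> ~~ incident x e) ->
     same_ball n S S' w ->
     ratio_bounds a b (k%:R * odds S w) (k%:R * odds S' w)) ->
  u \notin S -> u \notin S' -> {in es, forall e, incident u e} ->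
  same_ball n.+1 S S' u ->
  prod_bounds a b (size es) (Z S' / Z (foldl remove S' es))
                            (Z S / Z (foldl remove S es)).
Proof.
move=> a0 ab IH; elim: es S S' => [|e es IHes] S S' uS uS' ues SS' /=.
  by rewrite !divff ?gt_eqF ?partition_function_gt0//; exact: prod_bounds0.
have ue : incident u e by rewrite ues// mem_head.
have pos (V : {fset vertex T}) : 0 < Z V by exact: partition_function_gt0.
have quo (V V' : {fset vertex T}) e' : Z V / Z V' =
   (1 + \sum_(w <- [fset w in V | incident w e']) odds (remove V e') w) *
   (Z (remove V e') / Z V').
  by rewrite (partition_function_edge V e') mulrAC mulrC.
rewrite (quo S' _ e) (quo S _ e).
have WE : [fset w in S' | incident w e] = [fset w in S | incident w e].
  apply/fsetP => w; rewrite !inE/=; case we : (incident w e); rewrite ?andbT ?andbF//.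
  have [<-|uw] := eqVneq u w; first by rewrite (negPf uS) (negPf uS').
  rewrite (SS' [:: w])//= andbT /adjacent uw/=; apply/asboolP; by exists e.
rewrite WE; set W := [fset w in S | incident w e].
set x := \sum_(w <- W) odds (remove S e) w.
set y := \sum_(w <- W) odds (remove S' e) w.
have Wk : (#|` W| <= k)%N by exact: edge_card ue uS.
have sumk (c : R) : \sum_(w <- W) c = #|` W|%:R * c.
  by rewrite big_const_seq count_predT iter_addr_0 mulr_natl.
have [x0 y0] : 0 <= x /\ 0 <= y by rewrite /x /y; split; rewrite sumr_ge0// => w _; exact: odds_ge0.
have kR : 0 < k%:R :> R by rewrite ltr0n.
have child w : w \in W ->
    ratio_bounds a b (k%:R * odds (remove S e) w) (k%:R * odds (remove S' e) w).
  rewrite !inE => /andP[wS we]; apply: (IH _ _ _ e we).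
  - by move=> z; rewrite removeE => /andP[].
  - by move=> z; rewrite removeE => /andP[].
  - exact: same_ball_remove SS'.
apply: prod_bounds_cons => //; rewrite ?divr_gt0//.
  split.
    rewrite !mulr_sumr big_seq [leRHS]big_seq ler_sum// => w /child[+ _].
    by rewrite mulrCA [leRHS]mulrCA ler_pM2l.
  have : \sum_(w <- W) (1 + a) * (k%:R * odds (remove S' e) w) <=
         \sum_(w <- W) ((b - a) + (1 + b) * (k%:R * odds (remove S e) w)).
    by rewrite big_seq [leRHS]big_seq ler_sum// => w /child[_]; lra.
  rewrite big_split/= sumk -!mulr_sumr -/x -/y => h.
  (* Having fewer than [k] vertices on [e] is harmless, since [0 <= b - a]. *)
  have : #|` W|%:R * (b - a) <= k%:R * (b - a) by rewrite ler_wpM2r ?ler_nat//; lra.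
  move=> h'; have {h}h : k%:R * ((1 + a) * y) <= k%:R * (b - a + (1 + b) * x) by lra.
  by move: h; rewrite ler_pM2l//; lra.
apply: IHes.
- by rewrite removeE negb_and uS.
- by rewrite removeE negb_and uS'.
- by move=> e' e'es; rewrite ues// inE e'es orbT.
- move=> p up pn; rewrite !removeE; congr (_ && _); exact: SS'.
Qed.


Lemma partition_function_remove S es : Z (foldl remove S es) <= Z S.
Proof.
elim: es S => //= e es IHes S; apply: le_trans (IHes _) _.
rewrite [leRHS](partition_function_edge S e) ler_peMr//.
  exact: ltW (partition_function_gt0 _).
by rewrite lerDl sumr_ge0// => w _; exact: odds_ge0.
Qed.

Lemma quotient_ge1 S es : 1 <= Z S / Z (foldl remove S es).
Proof.
by rewrite ler_pdivlMr ?partition_function_gt0// mul1r partition_function_remove.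
Qed.

Variable d : nat.
Hypothesis edge_seq : forall v, exists es : seq (hyperedge T),
  [/\ uniq es, size es = d.+1 & forall e, (e \in es) = incident v e].

Notation f := (tree_map k d lambda).

Definition extremes n : R * R := iter n (fun x => (f x.2, f x.1)) (0, f 0).

Lemma tree_map_anti (x y : R) : 0 <= x -> x <= y -> f y <= f x.
Proof.
move=> x0 xy; rewrite /tree_map ler_wpM2l ?mulr_ge0 ?ler0n ?(ltW lambda_gt0)//.
by rewrite lef_pV2 ?posrE ?exprn_gt0// ?lerXn2r ?nnegrE//; lra.
Qed.

Lemma tree_map_gt0 (x : R) : 0 <= x -> 0 < f x.
Proof. by move=> x0; rewrite !(divr_gt0, mulr_gt0) ?ltr0n// exprn_gt0//; lra. Qed.

(** The antitone [f] nests the intervals, which is the shrinking required by [prod_bounds_step]. *)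
Lemma extremes_monotone n :
  [/\ 0 <= (extremes n).1, (extremes n).1 <= (extremes n.+1).1,
      (extremes n.+1).1 <= (extremes n.+1).2 & (extremes n.+1).2 <= (extremes n).2].
Proof.
have f0 := tree_map_gt0 (lexx 0).
elim: n => [|n [a0 aa ab bb]].
  rewrite /extremes/=; split=> //; first exact: ltW (tree_map_gt0 (ltW f0)).
  exact: tree_map_anti (ltW f0).
have [b0 b1 a1] : [/\ 0 <= (extremes n).2, 0 <= (extremes n.+1).2 &
   0 <= (extremes n.+1).1] by split; lra.
by split=> //; rewrite /extremes !iterS/=; apply: tree_map_anti => //; lra.
Qed.

Lemma same_ball_sym n S S' u : same_ball n S S' u -> same_ball n S' S u.
Proof. by move=> h p up pn; rewrite h. Qed.

(** The edge [e] leads back to the parent; it carries no vertex of either set, so [d] edges remain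
    at [w]. The recursion takes a reciprocal, hence the step compares the children with [S] and [S']
    exchanged. *)
Lemma odds_bounds n S S' w e : incident w e ->
  (forall x, x \in S -> ~~ incident x e) ->
  (forall x, x \in S' -> ~~ incident x e) ->
  same_ball n S S' w ->
  ratio_bounds (extremes n).1 (extremes n).2 (k%:R * odds S w) (k%:R * odds S' w).
Proof.
have kR : 0 < k%:R :> R by rewrite ltr0n.
elim: n S S' w e => [|n IHn] S S' w e we Se S'e SS'.
  (* At radius 0 the bound [k%:R * odds S' w <= f 0] is enough, because the lower extreme is 0. *)
  have c0 : 0 <= k%:R * lambda by rewrite mulr_ge0 ?ltW.
  have s0 : 0 <= k%:R * odds S w by rewrite mulr_ge0 ?ler0n ?odds_ge0.
  have : k%:R * odds S' w <= k%:R * lambda.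
    rewrite ler_pM2l// /odds ler_pdivrMr ?partition_function_gt0// ler_pM2l//.
    have [es [_ _ esE]] := edge_seq w; rewrite (away_foldl _ esE).
    exact: partition_function_remove.
  rewrite /= /tree_map addr0 expr1n divr1 /ratio_bounds mul0r addr0 mul1r.
  by rewrite mulr_ge0//; move: c0 s0;
    move: (k%:R * lambda) (k%:R * odds S w) (k%:R * odds S' w) => x y z; nra.
have [es [es_uniq es_size esE]] := edge_seq w.
have e_es : e \in es by rewrite esE.
have wS : w \notin S by apply/negP => /Se; rewrite we.
have wS' : w \notin S' by apply/negP => /S'e; rewrite we.
have awayE V : (forall x, x \in V -> ~~ incident x e) ->
    away V w = foldl remove V (rem e es).
  move=> Ve; rewrite (@away_foldl V w (e :: rem e es))/=; first by rewrite remove_disjoint.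
  by move=> e'; rewrite -(perm_mem (perm_to_rem e_es)) esE.
have size_rem : size (rem e es) = d by rewrite size_rem// es_size.
have [a0 aa ab bb] := extremes_monotone n.
have aleb : (extremes n).1 <= (extremes n).2 by lra.
have rem_inc : {in rem e es, forall e', incident w e'}.
  by move=> e' /mem_rem; rewrite esE.
have := edges_bounds a0 aleb IHn wS' wS rem_inc (same_ball_sym SS').
rewrite size_rem => /prod_bounds_step step.
have c0 : 0 < k%:R * lambda by rewrite mulr_gt0.
have := step _ a0 aleb c0 (quotient_ge1 _ _) (quotient_ge1 _ _) aa bb.
by rewrite /odds !awayE// !invf_div !mulrA.
Qed.

(** The root has no parent edge, whence the factor [d.+1]; [inv_gap] turns the comparison of
    products into a difference. *)
Lemma odds_gap n S S' v : v \notin S -> v \notin S' -> same_ball n.+1 S S' v ->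
  odds S v - odds S' v <= lambda * (d.+1%:R * ((extremes n).2 - (extremes n).1)).
Proof.
move=> vS vS' SS'; have [es [_ es_size esE]] := edge_seq v.
have [a0 aa ab bb] := extremes_monotone n.
have aleb : (extremes n).1 <= (extremes n).2 by lra.
have es_inc : {in es, forall e', incident v e'} by move=> e'; rewrite esE.
have [bnd _] := edges_bounds a0 aleb (@odds_bounds n) vS vS' es_inc SS'.
have := inv_gap a0 aleb (quotient_ge1 _ _) (quotient_ge1 _ _) bnd.
rewrite es_size !invf_div -(ler_pM2l lambda_gt0) mulrBr !mulrA.
by rewrite /odds !(away_foldl _ esE).
Qed.
End Recursion.

(** * Conditioning on a boundary configuration *)

Section Marginal.
Set Implicit Arguments.
Unset Strict Implicit.
Local Open Scope fset_scope.
Local Open Scope ring_scope.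
Variables (R : realType) (T : hypergraph) (lambda : R).
Hypothesis lambda_gt0 : 0 < lambda.
Hypothesis incident_exists : forall v, exists e : hyperedge T, incident v e.
Implicit Types (Psi S L O I : {fset vertex T}) (v w : vertex T).
Notation Z := (partition_function lambda).

Definition occupied L (sigma : {ffun L -> bool}) : {fset vertex T} :=
  [fset val x | x in [pred x : L | sigma x]].

Lemma occupied_sub L (sigma : {ffun L -> bool}) : occupied sigma `<=` L.
Proof. by apply/fsubsetP => x /imfsetP[y _ ->]; exact: valP. Qed.

Lemma agreesE L (sigma : {ffun L -> bool}) I :
  agrees sigma I = (I `&` L == occupied sigma).
Proof.
have occE (x : L) : (val x \in occupied sigma) = sigma x.
  apply/imfsetP/idP => [[y yO /val_inj ->]//|sx]; by exists x.
apply/forallP/eqP => [h|h x].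
  apply/fsetP => x; rewrite in_fsetI; have [xL|xL] := boolP (x \in L).
    by have := eqP (h [` xL]); rewrite andbT -occE/= => ->.
  by rewrite andbF; apply/esym/negbTE; apply: contra xL; apply/fsubsetP/occupied_sub.
by rewrite -occE -h in_fsetI (valP x) andbT.
Qed.

Lemma gibbs_prE Psi (A : pred {fset vertex T}) :
  gibbs_pr lambda Psi A =
  (\sum_(I <- fpowerset Psi | `[< independent I >] && A I) lambda ^+ #|` I|) / Z Psi.
Proof.
rewrite /gibbs_pr big_distrl/= big_seq_cond [LHS]big_mkcond [RHS]big_mkcond/=.
rewrite big_seq [RHS]big_seq; apply: eq_bigr => I IPsi; rewrite IPsi/=.
by rewrite /gibbs -fpowersetE IPsi/=; case: (A I); case: `[< _ >].
Qed.

Lemma marginal01 Psi v L (sigma : {ffun L -> bool}) :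
  feasible lambda Psi sigma -> 0 <= marginal lambda Psi v sigma <= 1.
Proof.
rewrite /feasible /marginal => pos; have gibbs_ge0 I : 0 <= gibbs lambda Psi I.
  rewrite /gibbs; case: ifP => // _.
  by rewrite divr_ge0 ?exprn_ge0 ?(ltW lambda_gt0) ?(ltW (partition_function_gt0 _ _)).
apply/andP; split.
  by rewrite divr_ge0 ?(ltW pos)// sumr_ge0.
rewrite ler_pdivrMr// mul1r /gibbs_pr big_mkcond [leRHS]big_mkcond/=.
by apply: ler_sum => I _; case: (v \in I) => //=; case: ifP.
Qed.

Definition free_part Psi L O :=
  [fset w in Psi | (w \notin L) && `[< forall o, o \in O -> ~~ meets o w >]].

Lemma feasible_occupied Psi L (sigma : {ffun L -> bool}) :
  feasible lambda Psi sigma ->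
  occupied sigma `<=` Psi /\ independent (occupied sigma).
Proof.
rewrite /feasible gibbs_prE => pos.
suff [I [IPsi indI /eqP IL]] : exists I, [/\ I `<=` Psi, independent I &
    I `&` L == occupied sigma].
  have OI : occupied sigma `<=` I by rewrite -IL fsubsetIl.
  by split; [exact: fsubset_trans IPsi|exact: independent_sub indI].
apply: contrapT => none; move: pos; rewrite big_seq_cond big1 ?mul0r ?ltxx//.
move=> I /andP[]; rewrite fpowersetE agreesE => IPsi /andP[/asboolP indI IL].
by case: none; exists I.
Qed.

(** Conditioning on [sigma] leaves the Gibbs measure on the free part, where [v] has odds [r]; the
    weight of the occupied boundary cancels. *)
Lemma marginalE Psi v L (sigma : {ffun L -> bool}) :
  feasible lambda Psi sigma -> v \in Psi -> v \notin L ->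
  (forall o, o \in occupied sigma -> ~~ meets o v) ->
  let r := odds lambda (free_part Psi L (occupied sigma) `\ v) v in
  marginal lambda Psi v sigma = r / (1 + r).
Proof.
move=> feas vPsi vL vO; have [OPsi indO] := feasible_occupied feas.
rewrite /marginal !gibbs_prE invf_div.
set O := occupied sigma; set S0 := free_part Psi L O.
have OL : O `<=` L := occupied_sub sigma.
have vS0 : v \in S0 by rewrite !inE vPsi vL; apply/asboolP.
have pos S : 0 < Z S by exact: partition_function_gt0.
have denE : \sum_(I <- fpowerset Psi | `[< independent I >] && agrees sigma I)
    lambda ^+ #|` I| = lambda ^+ #|` O| * Z S0.
  rewrite -(@pinned_sum _ _ _ Psi S0 L O)//; last by move=> w; rewrite !inE.
  by apply: eq_bigl => I; rewrite agreesE.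
(* Occupation of [v] is one more pinned site: [v] joins both [L] and [O]. *)
have numE : \sum_(I <- fpowerset Psi | `[< independent I >] &&
    ((v \in I) && agrees sigma I)) lambda ^+ #|` I| =
    lambda ^+ #|` O| * (lambda * Z (away S0 v)).
  have vO' : v \notin O by apply: contra vL; exact: (fsubsetP OL).
  rewrite mulrA -exprSr -add1n -(_ : #|` v |` O| = (1 + #|` O|)%N); last first.
    by rewrite cardfsU1 vO'.
  rewrite -(@pinned_sum _ _ _ Psi (away S0 v) (v |` L) (v |` O))//.
  - apply: eq_bigl => I; congr (_ && _); rewrite agreesE.
    apply/andP/eqP => [[vI /eqP/fsetP h]|/fsetP h].
      apply/fsetP => x; move: (h x); rewrite !inE.
      by have [->|] := eqVneq x v; rewrite ?vI//.
    have vI : v \in I by move: (h v); rewrite !inE eqxx andbT.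
    split=> //; apply/eqP/fsetP => x; move: (h x); rewrite !inE.
    have [->|//] := eqVneq x v.
    by rewrite (negPf vL) (negPf vO') andbF.
  - by rewrite fsubUset fsub1set vPsi.
  - exact: fsetUS.
  - move=> e x y; rewrite !inE => /orP[/eqP ->|xO] /orP[/eqP ->|yO] xe ye //.
    + by have /negP[] := vO _ yO; apply/asboolP; exists e.
    + by have /negP[] := vO _ xO; apply/asboolP; exists e.
    + exact: indO xe ye.
  move=> w; rewrite !inE/= -andbA; congr (_ && _); rewrite negb_or.
  apply/andP/andP.
    move=> [/andP[wL /asboolP wO] vw]; split.
      rewrite wL andbT; apply: contraNneq vw => ->; exact: meetsxx.
    by apply/asboolP => o; rewrite !inE => /orP[/eqP ->|/wO].
  move=> [/andP[wv ->] /asboolP wO]; split; last by apply: wO; rewrite !inE eqxx.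
  by apply/asboolP => o oO; apply: wO; rewrite !inE oO orbT.
have split : Z S0 = Z (S0 `\ v) + lambda * Z (away S0 v).
  rewrite [LHS](bigID (fun I => v \in I))/= addrC occupied_sum//; congr (_ + _).
  rewrite -[RHS]mul1r -[1](expr0 lambda) -(cardfs0 (vertex T)).
  rewrite -(@pinned_sum _ _ _ S0 (S0 `\ v) [fset v] fset0 (fsub0set _) (fsub0set _)
    (@independent0 _)).
    apply: eq_bigl => I; congr (_ && _); apply/idP/eqP => [vI|/fsetP/(_ v)].
      by apply/fsetP => x; rewrite !inE; case: eqP => [->|]; rewrite ?andbF ?andbT ?(negPf vI).
    by rewrite !inE eqxx andbT => ->.
  move=> w; rewrite !inE/= andbC; congr (_ && _).
  by rewrite asboolT ?andbT// => o; rewrite inE.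
have awayE : away (S0 `\ v) v = away S0 v.
  apply/fsetP => w; rewrite !inE/=; have [->|//] := eqVneq w v.
  by rewrite meetsxx// !andbF.
rewrite numE denE split /odds awayE.
move: (pos (S0 `\ v)) (pos (away S0 v)) (pos Psi).
have := exprn_gt0 #|` O| lambda_gt0.
move: (lambda ^+ _) (Z _) (Z _) (Z _) lambda_gt0 => A B C D l0 A0 B0 C0 D0.
have lC := mulr_gt0 l0 C0.
by field; rewrite ?gt_eqF//; lra.
Qed.
End Marginal.

(** * Weak spatial mixing in terms of the extremes *)

Section Mixing.
Set Implicit Arguments.
Unset Strict Implicit.
Local Open Scope fset_scope.
Local Open Scope ring_scope.
Variables (R : realType) (k d : nat) (lambda : R).
Hypotheses (k_gt0 : (0 < k)%N) (lambda_gt0 : 0 < lambda).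

(** All neighbours of [inl v] have the form [inr e], so extracting the edges with [pmap] keeps all
    [d.+1] of them. *)
Lemma hypertree_edges (T : hypergraph) : is_hypertree k d T ->
  forall v : vertex T, exists es : seq (hyperedge T),
    [/\ uniq es, size es = d.+1 & forall e, (e \in es) = incident v e].
Proof.
move=> [_ deg _] v; pose A := [set y | @incidence_graph T (inl v) y]%classic.
have finA : finite_set A by exists d.+1; exact: deg.
pose getr (y : vertex T + hyperedge T) := if y is inr e then Some e else None.
have memA y : (y \in fset_set A) = incidence_graph (inl v) y.
  by rewrite in_fset_set//; apply/idP/idP; rewrite inE.
have getrK : ocancel getr inr by case.
exists (pmap getr (fset_set A)); split.
- by apply: (pmap_uniq getrK); exact: fset_uniq.
- rewrite size_pmap -(card_fset_set (deg v)) -[RHS]count_predT.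
  by apply: eq_in_count => -[w|e]//; rewrite memA.
move=> e; rewrite (mem_pmap getr); apply/mapP/idP => [[[w|e']]|ve].
- by [].
- by rewrite memA => ve [->].
- by exists (inr e) => //; rewrite memA.
Qed.

Lemma hypertree_vertices (T : hypergraph) : is_hypertree k d T ->
  forall (S : {fset vertex T}) (u : vertex T) (e : hyperedge T),
    incident u e -> u \notin S -> (#|` [fset w in S | incident w e]| <= k)%N.
Proof.
move=> [_ _ deg] S u e ue uS; pose A := [set y | @incidence_graph T (inr e) y]%classic.
have finA : finite_set A by exists k.+1; exact: deg.
set W := [fset w in S | _].
have uW : u \notin W by rewrite !inE negb_and uS.
have : ([fset (inl w : vertex T + hyperedge T) | w in u |` W] `<=` fset_set A)%fset.
  apply/fsubsetP => y /imfsetP[w /= wW ->]; rewrite in_fset_set// inE/=.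
  by move: wW; rewrite !inE => /orP[/eqP ->//|/andP[]].
move/fsubset_leq_card; rewrite (card_fset_set (deg e)) card_imfset/=; last by move=> x y [].
by rewrite cardfsU1 uW.
Qed.

(** A boundary at distance [l] changes the free part no closer than its neighbours, at distance
    [l - 1]; the free parts agree up to radius [l - 2], and the root step uses up one more. For
    [l < 3] the bound 1 on a difference of probabilities is taken. *)
Definition decay_rate (l : nat) : R :=
  if (l < 3)%N then 1
  else lambda * (d.+1%:R * ((extremes lambda k d (l - 3)).2 - (extremes lambda k d (l - 3)).1)).

(** A vertex within distance [n] of [v] meets nothing in [L], since one further step would reach [L]
    too soon; the boundary values then have no say in its membership. *)
Lemma free_part_ball (T : hypergraph) (Psi L O O' : {fset vertex T}) v n :
  O `<=` L -> O' `<=` L ->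
  (forall p, path (@adjacent T) v p -> last v p \in L -> (n.+2 <= size p)%N) ->
  same_ball n (free_part Psi L O `\ v) (free_part Psi L O' `\ v) v.
Proof.
move=> OL O'L dist p vp pn.
have wL : last v p \notin L.
  by apply/negP => /(dist _ vp); rewrite leqNgt ltnS (leq_trans pn).
have far (o : vertex T) : o \in L -> ~~ meets o (last v p).
  move=> oL; apply/negP => /asboolP[e [oe pe]].
  have /dist : path (@adjacent T) v (rcons p o).
    rewrite rcons_path vp /adjacent (contraNneq _ wL) => [/=|->//].
    by apply/asboolP; exists e.
  by rewrite last_rcons size_rcons => /(_ oL); rewrite !ltnS leqNgt ltnS pn.
rewrite !inE/= wL /=; congr [&& _, _ & _].
by rewrite !asboolT// => o oO; apply: far; [exact: (fsubsetP O'L)|exact: (fsubsetP OL)].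
Qed.

Lemma hypertree_mixing (T : hypergraph) : is_hypertree k d T ->
  weak_spatial_mixing T lambda decay_rate.
Proof.
move=> hyp Psi v L sigma tau l vPsi LPsi fs ft [_ dist].
have edge_seq := hypertree_edges hyp.
have inc : forall v : vertex T, exists e : hyperedge T, incident v e.
  move=> u; have [[|e es] [_ // es_size esE]] := edge_seq u.
  by exists e; rewrite -esE mem_head.
rewrite /decay_rate; case: ltnP => l3.
  have /andP[s0 s1] := marginal01 lambda_gt0 v fs.
  have /andP[t0 t1] := marginal01 lambda_gt0 v ft.
  rewrite ler_norml; lra.
have [n ln] : exists n, l = n.+3 by exists (l - 3)%N; lia.
rewrite {l3}ln in dist *; rewrite -addn3 addnK.
have vL : v \notin L by apply/negP => /(dist [::] isT).
have vO (rho : {ffun L -> bool}) : forall o, o \in occupied rho -> ~~ meets o v.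
  move=> o oO; have oL := fsubsetP (occupied_sub rho) _ oO.
  apply/negP => /asboolP[e [oe ve]].
  have /dist : path (@adjacent T) v [:: o].
    rewrite /= andbT /adjacent (contraNneq _ vL) => [/=|->//].
    by apply/asboolP; exists e.
  by move=> /(_ oL).
rewrite (marginalE lambda_gt0 inc fs vPsi vL (vO _)).
rewrite (marginalE lambda_gt0 inc ft vPsi vL (vO _)).
set S := _ `\ v; set S' := _ `\ v.
have ball : same_ball n.+1 S S' v by apply: free_part_ball dist; exact: occupied_sub.
have [vS vS'] : v \notin S /\ v \notin S' by rewrite !inE eqxx.
have gap := @odds_gap _ _ _ lambda_gt0 inc _ k_gt0 (hypertree_vertices hyp) _ edge_seq n.
have := gap _ _ _ vS vS' ball.
have := gap _ _ _ vS' vS (same_ball_sym ball).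
have := odds_ge0 lambda_gt0 S v.
have := odds_ge0 lambda_gt0 S' v.
move: (odds _ S v) (odds _ S' v) (lambda * _) => x y z x0 y0 xy yx.
(* The map [x / (1 + x)] is 1-Lipschitz on nonnegative reals, so a gap between odds bounds the gap
   between marginals. *)
have -> : x / (1 + x) - y / (1 + y) = (x - y) / ((1 + x) * (1 + y)) by field; lra.
have den : 1 <= (1 + x) * (1 + y) by nra.
have den0 : 0 < (1 + x) * (1 + y) by lra.
rewrite normrM normfV (gtr0_norm den0) ler_pdivrMr//.
have xyz : `|x - y| <= z by rewrite ler_norml; lra.
by apply: le_trans xyz _; rewrite ler_peMr//; lra.
Qed.
End Mixing.

(** * Elementary inequalities behind the two rates *)

Section Rates.
Set Implicit Arguments.
Unset Strict Implicit.
Variable R : realType.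
Implicit Types (d : nat) (z c : R).

(** Without the square, and divided by [z ^+ d.+2], this is Bernoulli's inequality for [z^-1] with
    exponent [d.+2]. At [d = 0] the square is the whole expression. *)
Lemma geometric_tangent d z : 0 < z ->
  0 <= d.+1%:R * z ^+ d.+2 - d.+2%:R * z ^+ d.+1 + 1 - (z - 1) ^+ 2 * (d == 0)%:R.
Proof.
move=> z0; elim: d => [|d IHd].
  rewrite mulr1 [X in _ <= X](_ : _ = 0)//; ring.
have mono : 0 <= (z - 1) * (z ^+ d.+2 - 1).
  have [z1|z1] := leP 1 z.
    by rewrite mulr_ge0// subr_ge0// exprn_ege1.
  by rewrite nmulr_rge0 ?subr_le0 ?subr_lt0// exprn_ile1// ltW.
have {}IHd : 0 <= d.+1%:R * z ^+ d.+2 - d.+2%:R * z ^+ d.+1 + 1.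
  have : 0 <= (z - 1) ^+ 2 * (d == 0)%:R by rewrite mulr_ge0 ?sqr_ge0 ?ler0n.
  by lra.
rewrite mulr0 subr0.
have -> : d.+2%:R * z ^+ d.+3 - d.+3%:R * z ^+ d.+2 + 1 =
    z * (d.+1%:R * z ^+ d.+2 - d.+2%:R * z ^+ d.+1 + 1) + (z - 1) * (z ^+ d.+2 - 1).
  rewrite !(exprS _ d.+2) !(exprS _ d.+1) -!natr1; ring.
by rewrite addr_ge0// mulr_ge0// ltW.
Qed.

(** The trapezoid rule for the convex function [z ^+ i] of [i]; [geometric_tangent] is the
    increment. The square is gained in the step from 0 to 1 and then carried along. *)
Lemma geometric_trapezoid d z : 0 < z ->
  2 * (\sum_(i < d.+1) z ^+ i) <= d%:R * z ^+ d.+1 + d.+2%:R - (d != 0)%:R * (z - 1) ^+ 2.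
Proof.
move=> z0; elim: d => [|d IHd]; first by rewrite big_ord1 expr0 /= !mul0r; lra.
rewrite big_ord_recr/= mulrDr mul1r.
have := geometric_tangent d z0; move: IHd.
case: d => [|d]; rewrite /= ?mul0r ?mul1r ?mulr1 ?mulr0 ?subr0.
  by rewrite big_ord1 expr0; lra.
rewrite [z ^+ d.+3]exprS ![in d.+4%:R]mulrSr ![in d.+3%:R]mulrSr ![in d.+2%:R]mulrSr.
by move: (\sum_(i < _) _) => s; lra.
Qed.

(** With [Q] the geometric sum, [z ^+ d = 1 + (z - 1) * Q], so the right side is
    [1 + ((z - 1) * Q)^-1] and the trapezoid bound applies. Its square yields the last term on the
    left, through [Q <= d%:R * z ^+ d]. *)
Lemma recip_upper d z : (0 < d)%N -> 1 < z ->
  d.+1%:R / (2 * d%:R) + (d%:R * (z - 1))^-1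
    + (1 < d)%:R * (z - 1) / (2 * d%:R ^+ 2 * z ^+ d) <= (1 - (z ^+ d)^-1)^-1.
Proof.
case: d => // d _ z1; have z0 : 0 < z by lra.
have := geometric_trapezoid d z0.
have -> : (1 < d.+1)%N = (d != 0) by case: (d).
have c0 : 0 <= (d != 0)%:R :> R by rewrite ler0n.
set Q := \sum_(i < d.+1) z ^+ i.
have wQ : z ^+ d.+1 = 1 + (z - 1) * Q by rewrite -subrX1 addrC subrK.
have Q1 : 1 <= Q.
  rewrite /Q big_ord_recl expr0 lerDl sumr_ge0// => i _; exact: exprn_ge0 (ltW z0).
have Qle : Q <= d.+1%:R * z ^+ d.+1.
  have -> : d.+1%:R * z ^+ d.+1 = \sum_(i < d.+1) z ^+ d.+1.
    by rewrite sumr_const card_ord mulr_natl.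
  by apply: ler_sum => i _; apply: ler_weXn2l; [exact: ltW|exact: ltnW (ltn_ord i)].
have D1 : 1 <= d.+1%:R :> R by rewrite ler1n.
rewrite -[d.+2%:R]natr1 (_ : d%:R = d.+1%:R - 1); last by rewrite -natr1 addrK.
move: Q1 Qle wQ D1 c0; move: ((d != 0)%:R) (d.+1%:R) (z ^+ d.+1) Q => c D w Q Q1 Qle wQ D1 c0.
move=> trap; have u0 : 0 < z - 1 by lra.
move: (z - 1) u0 wQ trap => u u0 wQ trap.
have uQ := mulr_gt0 u0 (_ : 0 < Q); have {}uQ := uQ ltac:(lra).
have w0 : 0 < w by lra.
have -> : (1 - w^-1)^-1 = 1 + (u * Q)^-1.
  by rewrite wQ; field; rewrite !gt_eqF//; lra.
have h1 : c * u / (2 * D ^+ 2 * w) <= c * u / (2 * D * Q).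
  rewrite ler_wpM2l ?mulr_ge0 ?(ltW u0)// lef_pV2 ?posrE.
  - by rewrite expr2 mulrA -[leRHS]mulrA ler_wpM2l//; lra.
  - by rewrite !mulr_gt0 ?exprn_gt0//; lra.
  - by rewrite !mulr_gt0//; lra.
have -> : 1 + (u * Q)^-1 = (D + 1) / (2 * D) + (D * u)^-1 +
    ((D - 1) * (u * Q) + 2 * (D - Q)) / (2 * D * Q * u).
  by field; rewrite !gt_eqF//; lra.
rewrite lerD2l; apply: le_trans h1 _.
have -> : c * u / (2 * D * Q) = c * u ^+ 2 / (2 * D * Q * u).
  by field; rewrite !gt_eqF//; lra.
have den0 : 0 < 2 * D * Q * u by rewrite !mulr_gt0//; lra.
rewrite ler_pM2r ?invr_gt0//.
by move: trap; rewrite wQ; lra.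
Qed.

(** As for [z > 1], but the right side is now [((1 - z) * Q)^-1 - 1], and [Q <= d%:R]. *)
Lemma recip_lower d z : (0 < d)%N -> 0 < z -> z < 1 ->
  - (d.+1%:R / (2 * d%:R)) + (d%:R * (1 - z))^-1
    + (1 < d)%:R * (1 - z) / (2 * d%:R ^+ 2) <= ((z ^+ d)^-1 - 1)^-1.
Proof.
case: d => // d _ z0 z1.
have := geometric_trapezoid d z0.
have -> : (1 < d.+1)%N = (d != 0) by case: (d).
have c0 : 0 <= (d != 0)%:R :> R by rewrite ler0n.
set Q := \sum_(i < d.+1) z ^+ i.
have wQ : z ^+ d.+1 = 1 - (1 - z) * Q.
  by rewrite -[in RHS](opprB z) mulNr opprK -subrX1 addrC subrK.
have Q1 : 1 <= Q.
  rewrite /Q big_ord_recl expr0 lerDl sumr_ge0// => i _; exact: exprn_ge0 (ltW z0).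
have Qle : Q <= d.+1%:R.
  have -> : d.+1%:R = \sum_(i < d.+1) 1 :> R by rewrite sumr_const card_ord.
  by apply: ler_sum => i _; rewrite exprn_ile1// ltW.
have D1 : 1 <= d.+1%:R :> R by rewrite ler1n.
have w0 : 0 < z ^+ d.+1 by rewrite exprn_gt0.
rewrite -[d.+2%:R]natr1 (_ : d%:R = d.+1%:R - 1); last by rewrite -natr1 addrK.
rewrite (_ : (z - 1) ^+ 2 = (1 - z) ^+ 2); last by ring.
move: Q1 Qle wQ D1 c0 w0.
move: ((d != 0)%:R) (d.+1%:R) (z ^+ d.+1) Q => c D w Q Q1 Qle wQ D1 c0 w0.
move=> trap; have u0 : 0 < 1 - z by lra.
move: (1 - z) u0 wQ trap => u u0 wQ trap.
have uQ := mulr_gt0 u0 (_ : 0 < Q); have {}uQ := uQ ltac:(lra).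
have -> : (w^-1 - 1)^-1 = (u * Q)^-1 - 1.
  by rewrite wQ; field; rewrite -?wQ !gt_eqF//; lra.
have h1 : c * u / (2 * D ^+ 2) <= c * u / (2 * D * Q).
  rewrite ler_wpM2l ?mulr_ge0 ?(ltW u0)// lef_pV2 ?posrE.
  - by rewrite expr2 mulrA ler_wpM2l//; lra.
  - by rewrite !mulr_gt0 ?exprn_gt0//; lra.
  - by rewrite !mulr_gt0//; lra.
have -> : (u * Q)^-1 - 1 = - ((D + 1) / (2 * D)) + (D * u)^-1 +
    (2 * (D - Q) - (D - 1) * (u * Q)) / (2 * D * Q * u).
  by field; rewrite !gt_eqF//; lra.
rewrite lerD2l; apply: le_trans h1 _.
have -> : c * u / (2 * D * Q) = c * u ^+ 2 / (2 * D * Q * u).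
  by field; rewrite !gt_eqF//; lra.
have den0 : 0 < 2 * D * Q * u by rewrite !mulr_gt0//; lra.
rewrite ler_pM2r ?invr_gt0//.
by move: trap; rewrite wQ; lra.
Qed.

(** Squaring the recursion gives a gain of [2 * c] per two steps. The [c] added on the right covers
    the start at [n = 1]. *)
Lemma sqrt_growth (X : nat -> R) c : 0 <= c ->
  (forall n, 0 < X n) -> (forall n, X n + c / X n <= X n.+2) ->
  forall n, c * n%:R <= X n ^+ 2 + c.
Proof.
move=> c0 X0 step.
have step2 n : X n ^+ 2 + 2 * c <= X n.+2 ^+ 2.
  have cX : 0 <= c / X n by rewrite divr_ge0 ?(ltW (X0 n)).
  have h : (X n + c / X n) ^+ 2 <= X n.+2 ^+ 2.
    by rewrite lerXn2r ?nnegrE ?step// ?addr_ge0 ?(ltW (X0 _)).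
  apply: le_trans h.
  have -> : (X n + c / X n) ^+ 2 = X n ^+ 2 + 2 * c + (c / X n) ^+ 2.
    by field; rewrite gt_eqF.
  by rewrite lerDl sqr_ge0.
suff h n : c * n%:R <= X n ^+ 2 + c /\ c * n.+1%:R <= X n.+1 ^+ 2 + c by move=> n; have [] := h n.
elim: n => [|n [IH1 IH2]].
  by rewrite mulr0 mulr1 addr_ge0 ?sqr_ge0// lerDr sqr_ge0.
split=> //; have := step2 n; rewrite -[n.+2%:R]natr1 -[n.+1%:R]natr1; lra.
Qed.

Lemma geometric_growth (U V : nat -> R) r : 0 < r -> 0 < U 0%N -> 0 < V 0%N ->
  (forall n, U n / r <= V n.+1) -> (forall n, V n / r <= U n.+1) ->
  exists2 K, 0 < K & forall n, K / r ^+ n <= U n /\ K / r ^+ n <= V n.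
Proof.
move=> r0 U0 V0 UV VU; exists (Num.min (U 0%N) (V 0%N)).
  by rewrite lt_min U0.
elim=> [|n [hU hV]]; first by rewrite expr0 divr1 !ge_min !lexx orbT.
have rV : 0 <= r^-1 by rewrite invr_ge0 ltW.
rewrite exprSr invfM mulrA; split.
  by apply: le_trans (VU n); rewrite ler_wpM2r.
by apply: le_trans (UV n); rewrite ler_wpM2r.
Qed.
End Rates.

(** * The fixed point and the convergence of the extremes to it *)

Section FixedPoint.
Set Implicit Arguments.
Unset Strict Implicit.
Variables (R : realType) (k d : nat) (lambda : R).
Hypotheses (k_gt0 : (0 < k)%N) (d_gt0 : (0 < d)%N) (lambda_gt0 : 0 < lambda).
Notation f := (tree_map k d lambda).
Let kl_gt0 : 0 < k%:R * lambda.
Proof. by rewrite mulr_gt0 ?ltr0n. Qed.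

Lemma tree_map_lt (x y : R) : 0 <= x -> x < y -> f y < f x.
Proof.
move=> x0 xy; rewrite /tree_map ltr_pM2l// ltf_pV2 ?posrE ?exprn_gt0//; try lra.
by rewrite ltrXn2r ?nnegrE// -?lt0n//; lra.
Qed.

Lemma tree_map_fixed : exists x, unique (fun x => 0 < x /\ f x = x) x.
Proof.
pose p : {poly R} := 'X * (1 + 'X) ^+ d - (k%:R * lambda)%:P.
have pE x : p.[x] = x * (1 + x) ^+ d - k%:R * lambda.
  by rewrite /p !hornerE.
have [||x /andP[x0 xc] /rootP] := @poly_ivt R p 0 (k%:R * lambda).
- exact: ltW.
- rewrite !pE mul0r sub0r oppr_le0 (ltW kl_gt0) subr_ge0/= ler_peMr ?(ltW kl_gt0)//.
  by rewrite exprn_ege1// lerDl ltW.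
rewrite pE => /eqP; rewrite subr_eq0 => /eqP px.
have x_gt0 : 0 < x.
  rewrite lt_neqAle x0 andbT; apply/eqP => xz.
  by move: kl_gt0; rewrite -px -xz mul0r ltxx.
have fx : f x = x.
  by rewrite /tree_map -px mulfK// expf_neq0// gt_eqF//; lra.
exists x; split=> // y [y0 fy]; have [xy|yx|//] := ltgtP x y.
  by have := tree_map_lt x0 xy; rewrite fx fy; lra.
by have := tree_map_lt (ltW y0) yx; rewrite fx fy; lra.
Qed.

Lemma tree_map_derive (xhat : R) : 0 < xhat -> f xhat = xhat ->
  `| (f^`())%classic xhat | = d%:R * xhat / (1 + xhat).
Proof.
move=> xhat_gt0 xhatE; pose q : {poly R} := (1 + 'X) ^+ d.
have qE x : q.[x] = (1 + x) ^+ d by rewrite /q !hornerE.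
have q0 : q.[xhat] != 0 by rewrite qE expf_neq0// gt_eqF//; lra.
have dq : is_derive xhat 1 (horner q) (q^`()).[xhat] by exact: is_derive_poly.
have -> : f = (fun x => (k%:R * lambda) * (q.[x])^-1).
  by apply/funext => x; rewrite /tree_map qE.
have dV : derivable (fun x => (q.[x])^-1) xhat 1 by apply: derivableV.
rewrite derive1E.
have -> : 'D_1 (fun x => k%:R * lambda * (q.[x])^-1) xhat =
          k%:R * lambda * 'D_1 (fun x => (q.[x])^-1) xhat by apply: deriveMl.
rewrite deriveV// derive_val.
have -> : (q^`()).[xhat] = d%:R * (1 + xhat) ^+ d.-1.
  by rewrite /q deriv_exp derivD derivC derivX add0r mul1r hornerMn !hornerE mulr_natl.
have kE : k%:R * lambda = xhat * (1 + xhat) ^+ d.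
  by rewrite -{1}xhatE /tree_map divfK// expf_neq0// gt_eqF//; lra.
rewrite kE qE; case: (d) d_gt0 => // m _ /=; rewrite exprS.
have w0 : 0 < (1 + xhat) ^+ m by rewrite exprn_gt0//; lra.
move: w0; move: ((1 + xhat) ^+ m) (m.+1%:R : R) (ler0n R m.+1) => w D D0 w0.
rewrite [X in `|X|](_ : _ = - (D * xhat / (1 + xhat))); last first.
  by rewrite /GRing.scale/=; field; rewrite !gt_eqF//; lra.
by rewrite normrN ger0_norm// divr_ge0 ?mulr_ge0//; lra.
Qed.

Notation lo n := (extremes lambda k d n).1.
Notation hi n := (extremes lambda k d n).2.

(** The relative errors [A_n] and, below, [B_n]. *)
Definition lower_gap (x : R) n : R := 1 - lo n / x.
Definition upper_gap (x : R) n : R := hi n / x - 1.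

Lemma extremes_around (x : R) n : 0 < x -> f x = x ->
  [/\ 0 <= lo n, lo n < x & x < hi n].
Proof.
move=> x0 fx; elim: n => [|n [a0 ax xb]].
  by rewrite /extremes/=; split=> //; rewrite -{1}fx tree_map_lt.
rewrite /extremes iterS/=; split.
- by rewrite ltW// tree_map_gt0//; lra.
- by rewrite -{1}fx tree_map_lt//; lra.
- by rewrite -{1}fx tree_map_lt//; lra.
Qed.

Lemma hi_le0 n : hi n <= hi 0.
Proof.
elim: n => // n; apply: le_trans.
by have [_ _ _] := extremes_monotone lambda_gt0 k_gt0 d n.
Qed.

Lemma gap_range (x : R) n : 0 < x -> f x = x ->
  [/\ 0 < lower_gap x n, lower_gap x n <= 1,
      0 < upper_gap x n & upper_gap x n <= upper_gap x 0].
Proof.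
move=> x0 fx; have [a0 ax xb] := extremes_around n x0 fx.
split; rewrite /lower_gap /upper_gap.
- by rewrite subr_gt0 ltr_pdivrMr// mul1r.
- by rewrite gerBl divr_ge0// ltW.
- by rewrite subr_gt0 ltr_pdivlMr// mul1r.
- by rewrite lerD2r ler_pM2r ?invr_gt0// hi_le0.
Qed.

Lemma tree_map_normalized (x y : R) : 0 < x -> f x = x -> 0 <= y ->
  f y / x = (((1 + y) / (1 + x)) ^+ d)^-1.
Proof.
move=> x0 fx y0; rewrite -{1}fx /tree_map expr_div_n.
have : 0 < (1 + y) ^+ d by rewrite exprn_gt0//; lra.
have : 0 < (1 + x) ^+ d by rewrite exprn_gt0//; lra.
move: (_ ^+ d) (_ ^+ d) (k%:R * lambda) kl_gt0 => u w c c0 u0 w0.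
by field; rewrite !gt_eqF//; lra.
Qed.

(** Dividing by [x = f x] cancels [k%:R * lambda], so one step raises [1 + psi * B n] or
    [1 - psi * A n] to the power [-d]; these are the values of [z] for [recip_upper] and
    [recip_lower]. *)
Lemma gap_step (x : R) : 0 < x -> f x = x ->
  let r := d%:R * x / (1 + x) in
  let theta : R := d.+1%:R / (2 * d%:R) in
  exists2 kappa : R, 0 <= kappa /\ ((1 < d)%N -> 0 < kappa) & forall n,
    theta + (r * upper_gap x n)^-1 + kappa * upper_gap x n <= (lower_gap x n.+1)^-1 /\
    - theta + (r * lower_gap x n)^-1 + kappa * lower_gap x n <= (upper_gap x n.+1)^-1.
Proof.
move=> x0 fx r theta.
have dR : 0 < d%:R :> R by rewrite ltr0n.
pose psi := x / (1 + x); have psi0 : 0 < psi by rewrite divr_gt0//; lra.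
have psi1 : psi < 1 by rewrite /psi ltr_pdivrMr; lra.
have [_ _ B00 _] := gap_range 0 x0 fx.
pose B n := upper_gap x n; pose A n := lower_gap x n.
pose z0 := 1 + psi * B 0.
have z01 : 1 <= z0 by rewrite lerDl mulr_ge0 ?ltW.
have z0d : 1 <= z0 ^+ d by rewrite exprn_ege1.
have den0 : 0 < 2 * d%:R ^+ 2 * z0 ^+ d by rewrite !mulr_gt0 ?exprn_gt0//; lra.
(* Since [z0] dominates every [1 + psi * B n], this constant serves all [n]. *)
exists ((1 < d)%:R * psi / (2 * d%:R ^+ 2 * z0 ^+ d)).
  split; first by apply: divr_ge0; [rewrite mulr_ge0 ?ler0n ?(ltW psi0)|exact: ltW].
  by move=> ->; rewrite mul1r divr_gt0.
move=> n; have [A0 A1 B0 BB] := gap_range n x0 fx.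
have [a0 ax xb] := extremes_around n x0 fx.
have [lo_eq hi_eq] : lo n = x * (1 - A n) /\ hi n = x * (1 + B n).
  by rewrite /A /B /lower_gap /upper_gap; split; field; rewrite gt_eqF.
have AE : lower_gap x n.+1 = 1 - ((1 + psi * B n) ^+ d)^-1.
  rewrite /lower_gap /= (tree_map_normalized x0 fx); last by lra.
  by rewrite hi_eq /psi; congr (1 - (_ ^+ _)^-1); field; lra.
have BE : upper_gap x n.+1 = ((1 - psi * A n) ^+ d)^-1 - 1.
  rewrite /upper_gap /= (tree_map_normalized x0 fx a0).
  by rewrite lo_eq /psi; congr ((_ ^+ _)^-1 - 1); field; lra.
rewrite AE BE -/(A n) -/(B n).
have rE : r = d%:R * psi by rewrite /r mulrA.
have b01 : 0 <= (1 < d)%:R :> R by rewrite ler0n.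
have [u0 v0] := (mulr_gt0 psi0 B0, mulr_gt0 psi0 A0).
split.
  have z1 : 1 < 1 + psi * B n by rewrite ltrDl.
  have := recip_upper d_gt0 z1.
  rewrite (_ : 1 + psi * B n - 1 = psi * B n); last by ring.
  rewrite rE -[d%:R * psi * _]mulrA; apply: le_trans; rewrite lerD2l.
  rewrite [X in X <= _](mulrAC _ _ (B n)) -(mulrA _ psi (B n)).
  rewrite ler_wpM2l//; first by rewrite mulr_ge0// ltW.
  have zn : 0 < (1 + psi * B n) ^+ d by rewrite exprn_gt0//; lra.
  have den1 : 0 < 2 * d%:R ^+ 2 * (1 + psi * B n) ^+ d.
    by rewrite mulr_gt0// mulr_gt0// exprn_gt0.
  rewrite lef_pV2 ?posrE//.
  rewrite ler_wpM2l ?mulr_ge0 ?exprn_ge0 ?ler0n// lerXn2r ?nnegrE//; try lra.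
  by rewrite lerD2l ler_pM2l.
have z1 : 1 - psi * A n < 1 by rewrite gtrBl.
have z0' : 0 < 1 - psi * A n by nra.
have := recip_lower d_gt0 z0' z1.
rewrite (_ : 1 - (1 - psi * A n) = psi * A n); last by ring.
rewrite rE -[d%:R * psi * _]mulrA; apply: le_trans; rewrite lerD2l.
rewrite [X in X <= _](mulrAC _ _ (A n)) -(mulrA _ psi (A n)).
rewrite ler_wpM2l//; first by rewrite mulr_ge0// ltW.
have den1 : 0 < 2 * d%:R ^+ 2 :> R by rewrite mulr_gt0// exprn_gt0.
by rewrite lef_pV2 ?posrE// ler_peMr// ltW.
Qed.

Lemma extremes_gap_geometric (x : R) : 0 < x -> f x = x ->
  exists2 C : R, 0 < C & forall n, hi n - lo n <= C * (d%:R * x / (1 + x)) ^+ n.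
Proof.
move=> x0 fx; have [kappa [kappa0 _]] := gap_step x0 fx.
have D1 : 1 <= d%:R :> R by rewrite ler1n.
have dR : 0 < d%:R :> R by rewrite ltr0n.
set r := d%:R * x / (1 + x); set theta : R := d.+1%:R / (2 * d%:R) => step.
have r0 : 0 < r by apply: divr_gt0; [exact: mulr_gt0|lra].
have theta0 : 0 < theta by rewrite divr_gt0 ?mulr_gt0 ?ltr0n.
have theta1 : theta <= 1.
  rewrite /theta -[d.+1%:R]natr1; move: (d%:R : R) D1 => D D1.
  by rewrite ler_pdivrMr; lra.
(* Chosen so that [tau / r = theta - tau], which absorbs [theta] in both recursions. That [tau < 1]
   keeps [(lower_gap x 0)^-1 - tau] positive. *)
pose tau := theta * r / (1 + r).
have tauE : tau * (1 + r) = theta * r by rewrite /tau divfK// gt_eqF//; lra.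
have tau0 : 0 < tau by apply: divr_gt0; [exact: mulr_gt0|lra].
have tau1 : tau < 1 by rewrite /tau ltr_pdivrMr; nra.
have [range1 range2] := (fun n => gap_range n x0 fx, gap_range 0 x0 fx).
have [K K0 growth] : exists2 K, 0 < K & forall n,
    K / r ^+ n <= (upper_gap x n)^-1 + tau /\ K / r ^+ n <= (lower_gap x n)^-1 - tau.
  have tauV : tau / r = theta - tau.
    by rewrite /tau; field; rewrite !gt_eqF//; lra.
  apply: geometric_growth => //.
  - by rewrite addr_gt0// invr_gt0; have [] := range2.
  - rewrite subr_gt0; have [A0 A1 _ _] := range2.
    by apply: lt_le_trans tau1 _; rewrite invf_ge1.
  - move=> n; have [_ _ B0 _] := range1 n; have [+ _] := step n.
    have := mulr_ge0 kappa0 (ltW B0); rewrite invfM mulrDl tauV.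
    by rewrite [_ / r]mulrC; lra.
  - move=> n; have [A0 _ _ _] := range1 n; have [_ +] := step n.
    have := mulr_ge0 kappa0 (ltW A0); rewrite invfM mulrBl tauV.
    by rewrite [_ / r]mulrC; lra.
have [_ _ B00 _] := range2.
(* As [upper_gap x n <= upper_gap x 0], the shifted reciprocal is at most [M] times the plain
   one. *)
pose M := 1 + tau * upper_gap x 0.
have M1 : 1 <= M by rewrite lerDl mulr_ge0 ?ltW.
exists (x * (2 * M) / K); first by rewrite divr_gt0// !mulr_gt0//; lra.
move=> n; have [A0 A1 B0 BB] := range1 n; have [hU hV] := growth n.
have rn : 0 < r ^+ n by rewrite exprn_gt0.
have bound (y : R) : 0 < y -> K / r ^+ n <= M * y^-1 -> y <= M / K * r ^+ n.
  move=> y0; rewrite ler_pdivlMr// => h.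
  have -> : M / K * r ^+ n = M * (r ^+ n / K) by rewrite mulrAC mulrA.
  have {1}-> : y = K / r ^+ n * y * (r ^+ n / K).
    by field; rewrite !gt_eqF.
  by rewrite ler_wpM2r// ltW// divr_gt0.
have -> : hi n - lo n = x * (upper_gap x n + lower_gap x n).
  by rewrite /upper_gap /lower_gap; field; rewrite gt_eqF.
have hb : upper_gap x n <= M / K * r ^+ n.
  apply: bound => //; apply: le_trans hU _.
  rewrite mulrDl mul1r lerD2l ler_pdivlMr//.
  by rewrite ler_wpM2l// ltW.
have ha : lower_gap x n <= M / K * r ^+ n.
  apply: bound => //; apply: le_trans hV _.
  have : 1 * (lower_gap x n)^-1 <= M * (lower_gap x n)^-1 by rewrite ler_wpM2r// invr_ge0 ltW.
  by lra.
have -> : x * (2 * M) / K * r ^+ n = x * (M / K * r ^+ n + M / K * r ^+ n) by ring.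
by rewrite ler_pM2l// lerD.
Qed.

(** Over two steps [theta] and [- theta] cancel, so the reciprocals of both gaps satisfy the
    recursion of [sqrt_growth]. *)
Lemma extremes_gap_sqrt (x : R) : 0 < x -> f x = x -> (1 < d)%N ->
  d%:R * x / (1 + x) = 1 ->
  exists2 C : R, 0 < C & forall n, hi n.+2 - lo n.+2 <= C / Num.sqrt n.+1%:R.
Proof.
move=> x0 fx d1 r1; have [kappa [kappa0 /(_ d1) kappa_gt0]] := gap_step x0 fx.
rewrite r1; set theta := _ / _ => step.
have range n := gap_range n x0 fx.
have Agrow n : kappa * n%:R <= (lower_gap x n)^-1 ^+ 2 + kappa.
  apply: (@sqrt_growth _ (fun n => (lower_gap x n)^-1)) => // {}n.
    by rewrite invr_gt0; have [] := range n.
  rewrite invrK; have [+ _] := step n.+1; have [_ +] := step n.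
  have [_ _ B0 _] := range n.+1; have := mulr_ge0 kappa0 (ltW B0).
  by rewrite !mul1r; lra.
have Bgrow n : kappa * n%:R <= (upper_gap x n)^-1 ^+ 2 + kappa.
  apply: (@sqrt_growth _ (fun n => (upper_gap x n)^-1)) => // {}n.
    by rewrite invr_gt0; have [] := range n.
  rewrite invrK; have [_ +] := step n.+1; have [+ _] := step n.
  have [A0 _ _ _] := range n.+1; have := mulr_ge0 kappa0 (ltW A0).
  by rewrite !mul1r; lra.
exists (2 * x / Num.sqrt kappa); first by rewrite divr_gt0 ?mulr_gt0// sqrtr_gt0.
move=> n; have [A0 _ B0 _] := range n.+2.
have bound (y : R) : 0 < y -> kappa * n.+2%:R <= y^-1 ^+ 2 + kappa ->
    y <= (Num.sqrt kappa * Num.sqrt n.+1%:R)^-1.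
  move=> y0; rewrite -natr1 mulrDr mulr1 lerD2r => h.
  rewrite -[leLHS]invrK lef_pV2 ?posrE ?invr_gt0 ?mulr_gt0 ?sqrtr_gt0 ?ltr0n//.
  by rewrite -sqrtrM// -(ler_sqr _ _) ?nnegrE ?sqrtr_ge0 ?invr_ge0 ?(ltW y0)//
     sqr_sqrtr// mulr_ge0 ?ler0n.
have -> : hi n.+2 - lo n.+2 = x * (upper_gap x n.+2 + lower_gap x n.+2).
  by rewrite /upper_gap /lower_gap; field; rewrite gt_eqF.
have := lerD (bound _ B0 (Bgrow _)) (bound _ A0 (Agrow _)).
rewrite -(ler_pM2l x0) => /le_trans; apply; rewrite invfM.
by rewrite le_eqVlt; apply/orP; left; apply/eqP; ring.
Qed.
End FixedPoint.

(** * Assembly of the two rates and choice of the constants *)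

Theorem theorem20 (R : realType) (k d : nat) (lambda : R) :
  (0 < k)%N -> (0 < d)%N ->
  0 < lambda -> (lambda%:E <= lambda_c R k d)%E ->
  exists xhat : R,
    unique (fun x : R => 0 < x /\ tree_map k d lambda x = x) xhat /\
    `| ((tree_map k d lambda)^`())%classic xhat | = d%:R * xhat / (1 + xhat) /\
    exists (delta : nat -> R) (C1 C2 l0 : R),
      [/\ 0 < C1, 0 < C2, 0 < l0,
          forall T : hypergraph, is_hypertree k d T ->
            weak_spatial_mixing T lambda delta
        & exists N : nat, forall l : nat, (N <= l)%N ->
            ((lambda%:E < lambda_c R k d)%E ->
               delta l <= C1 * `| ((tree_map k d lambda)^`())%classic xhat | ^ (l%:Z - 4)) /\
            (lambda%:E = lambda_c R k d ->
               delta l <= C2 / Num.sqrt (l%:R - l0))].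
Proof.
move=> k0 d0 lam0 _; have [x [[x0 fx] xuniq]] := tree_map_fixed k0 d0 lam0.
exists x; split=> //; have dE := tree_map_derive d0 x0 fx.
split=> //; rewrite dE; have dR : 0 < d%:R :> R by rewrite ltr0n.
set r := d%:R * x / (1 + x).
have r0 : 0 < r by apply: divr_gt0; [exact: mulr_gt0|lra].
have [C C0 geo] := extremes_gap_geometric k0 d0 lam0 x0 fx.
move: geo; rewrite -/r => geo; clearbody r.
(* [C2] is chosen before criticality is assumed, hence the implication; off criticality any positive
   [C'] will do. *)
have [C' C'0 crit] : exists2 C' : R, 0 < C' & lambda%:E = lambda_c R k d ->
    forall n, (extremes lambda k d n.+2).2 - (extremes lambda k d n.+2).1 <= C' / Num.sqrt n.+1%:R.
  case: (pselect (lambda%:E = lambda_c R k d)) => [lamE|]; last by exists 1.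
  have d1 : (1 < d)%N.
    by move: lamE; rewrite /lambda_c; case: eqP => // d1 _; move: d0 d1; case: (d) => [|[]].
  have d1R : 0 < d%:R - 1 :> R by rewrite subr_gt0 ltr1n.
  have kR : 0 < k%:R :> R by rewrite ltr0n.
  (* At criticality this value solves the fixed point equation, and it makes the derivative 1 in
     absolute value. *)
  have xE : x = (d%:R - 1)^-1.
    apply: xuniq; split; first by rewrite invr_gt0.
    have -> : lambda = d%:R ^+ d / (k%:R * (d%:R - 1) ^+ d.+1).
      by move: lamE; rewrite /lambda_c gtn_eqF// => -[].
    rewrite /tree_map (_ : 1 + (d%:R - 1)^-1 = d%:R / (d%:R - 1)); last first.
      by field; rewrite gt_eqF.
    have Dd : 0 < d%:R ^+ d :> R by rewrite exprn_gt0.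
    have dd : 0 < (d%:R - 1) ^+ d :> R by rewrite exprn_gt0.
    rewrite expr_div_n exprS; move: Dd dd d1R kR.
    move: (k%:R : R) (d%:R - 1 : R) => e c; move: (d%:R ^+ d) (c ^+ d) => a b a0 b0 c0 e0.
    by field; rewrite !gt_eqF.
  have [|C' C'0 h] := extremes_gap_sqrt k0 d0 lam0 x0 fx d1; last by exists C'.
  rewrite xE; move: dR d1R; move: (d%:R : R) => D D0 D1.
  by field; rewrite !gt_eqF//; lra.
pose c := lambda * d.+1%:R; have c0 : 0 < c by rewrite mulr_gt0 ?ltr0n.
(* For [l = n + 5] the rate involves the extremes of index [l - 3 = n + 2], one above the exponent
   [l - 4]; this puts the factor [r] into [C1]. The square root bound at that index has
   [n + 1 = l - 4] under the root, so [l0 = 4]. *)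
exists (decay_rate k d lambda), (c * C * r), (c * C'), 4.
split.
- exact: mulr_gt0 (mulr_gt0 c0 C0) r0.
- exact: mulr_gt0.
- by [].
- by move=> T; exact: hypertree_mixing.
exists 5%N => l l5; have [n ->] : exists n, l = (n + 5)%N.
  by exists (l - 5)%N; rewrite subnK.
rewrite /decay_rate ifF; last by rewrite !addnS.
rewrite (_ : (n + 5 - 3)%N = n.+2); last by rewrite !addnS addn0.
rewrite mulrA -/c; clearbody c; split=> [_|lamE].
  have -> : (n + 5)%:Z - 4 = n.+1%:Z by lia.
  rewrite -exprnP -!mulrA -exprS ler_pM2l//; exact: geo.
have -> : (n + 5)%:R - 4 = n.+1%:R :> R by rewrite natrD -natr1; ring.
by rewrite -mulrA ler_pM2l//; exact: crit.
Qed.
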